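(* Consider the piecewise holomorphic systems $$\dot z=\tfrac{\mathrm i}{2}(z^2-1)+\epsilon R_m^\pm(z)\ \text{ when } \pm\operatorname{Im}(z)>0,\qquad R_m^\pm(z)=\sum_{l=0}^m\overline{a}^{\,\pm}_{0,l}\,z^{l},\quad a^\pm_{0,l}\in\mathbb C .$$ The following holds: (a) When $m=0$ the unique realizable configurations are $[[i,j]]$ with $0\le i+j\le1$, and when $m\in\{1,2\}$ the unique realizable configurations are $[[i,j]]$ with $i+j\le2$. (b) When $m=3$, if $[[i,j]]$ is a realizable configuration then $i,j\le3$. Moreover, the following configurations (satisfying $i,j\le3$) are realizable: $[[i,j]]$ with $0\le i+j\le4$ and $i,j\le 3$. (c) When $m>3$, if $[[i,j]]$ is a realizable configuration then $i,j\le2m-3$.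
   Context: Here $\overline{a}^{\,\pm}_{0,l}$ is the complex conjugate of $a^{\pm}_{0,l}$, and $0<\epsilon\ll1$. The unperturbed equation has centers at $-1$ and $1$. First order averaged function at $-1$: let $\phi(z)=\frac{1+z}{1-z}$ and, for $r\in(0,1)$, $M_1(r)=M_1^+(r)-M_1^-(r)$ with $$M_1^\pm(r)=-\operatorname{Im}\left(\int_0^{\pm\pi}\overline{\phi'\big(\phi^{-1}(re^{\mathrm i\theta})\big)R_m^\pm\big(\phi^{-1}(re^{\mathrm i\theta})\big)}\,\mathrm i e^{\mathrm i\theta}d\theta\right).$$ First order averaged function at $1$: $N_1(r)$ is the function obtained from $M_1(r)$ by replacing every coefficient $a^{\pm}_{0,l}$ by $(-1)^l a^{\mp}_{0,l}$ (this comes from the change $w(t)=-z(-t)$, which interchanges the two centers). For a fixed $m$, a system presents the configuration of limit cycles $[i,j]$ if $M_1$ and $N_1$ have simultaneously $i$ and $j$ simple zeros in $(0,1)$, respectively (then, for $\epsilon$ small, the system has $i$ limit cycles surrounding $-1$ and $j$ limit cycles surrounding $1$). By symmetry, $[i,j]$ occurs for some choice of coefficients if and only if $[j,i]$ does; in this case the configuration $[[i,j]]$ is called realizable (within the family of holomorphic perturbations considered here). *)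

(* Defs.v *)
(* Stdlib reals with Coquelicot. *)
From Stdlib Require Import Reals Lra Lia List.
From Coquelicot Require Import Coquelicot.
Open Scope R_scope.

(* The perturbation uses the conjugates of the coefficients [a 0], ..., [a m];
   the values [a l] with [l > m] are irrelevant. *)
Definition Rm (m : nat) (a : nat -> C) (z : C) : C :=
  sum_n (fun l => Cconj (a l) * z ^ l)%C m.

Definition phi (z : C) : C := ((1 + z) / (1 - z))%C.

Definition phi_inv (w : C) : C := ((w - 1) / (w + 1))%C.

Definition expi (theta : R) : C := (cos theta, sin theta).

(* One half of the first order averaged function, [T] being [PI] or [- PI]; the
   integral is oriented.  For [0 < r < 1] the point [r * expi theta] avoids the
   pole [-1] of [phi_inv], so the integrand is continuous. *)
Definition M1_half (m : nat) (a : nat -> C) (T r : R) : R :=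
  - Im (RInt (V := C_R_CompleteNormedModule)
          (fun theta : R =>
             (Cconj (C_derive phi (phi_inv (r * expi theta))
                     * Rm m a (phi_inv (r * expi theta)))
              * (Ci * expi theta))%C)
          0 T).

Definition M1 (m : nat) (ap am : nat -> C) (r : R) : R :=
  M1_half m ap PI r - M1_half m am (- PI) r.

Definition reflect_coef (a : nat -> C) (l : nat) : C := ((-1) ^ l * a l)%C.

Definition N1 (m : nat) (ap am : nat -> C) : R -> R :=
  M1 m (reflect_coef am) (reflect_coef ap).

Definition simple_zero (F : R -> R) (r : R) : Prop :=
  0 < r < 1 /\ F r = 0 /\ exists d : R, is_derive F r d /\ d <> 0.

(* There are [n] distinct simple zeros in (0,1); further zeros are not excluded.
   With exactly [n] zeros, three simple zeros of [M1 3 ap am] would force one of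
   [N1 3 ap am], and the configuration [[3,0]] would not occur for [m = 3]. *)
Definition has_simple_zeros (F : R -> R) (n : nat) : Prop :=
  exists s : list R,
    NoDup s /\ length s = n /\ forall r : R, In r s -> simple_zero F r.

Definition presents (m : nat) (ap am : nat -> C) (i j : nat) : Prop :=
  has_simple_zeros (M1 m ap am) i /\ has_simple_zeros (N1 m ap am) j.

(* Symmetric in [i] and [j], see [realizable_sym]. *)
Definition realizable (m i j : nat) : Prop :=
  exists ap am : nat -> C, presents m ap am i j.

Lemma phi_phi_inv (w : C) : w <> (-1)%C -> phi (phi_inv w) = w.
Proof.
intros Hw.
assert (H1 : (w + 1)%C <> 0%C).
{ intros H; apply Hw.
  replace w with ((w + 1) - 1)%C by ring. rewrite H.
  apply injective_projections; simpl; ring. }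
assert (H2 : RtoC 2 <> 0%C) by (intros H; apply RtoC_inj in H; lra).
unfold phi, phi_inv.
replace (1 + (w - 1) / (w + 1))%C with (2 * w / (w + 1))%C by (field; auto).
replace (1 - (w - 1) / (w + 1))%C with (2 / (w + 1))%C by (field; auto).
field; auto.
Qed.

Lemma Rm_ext (m : nat) (a b : nat -> C) (z : C) :
  (forall l, a l = b l) -> Rm m a z = Rm m b z.
Proof. intros H; apply sum_n_ext; intros l; now rewrite H. Qed.

Lemma M1_half_ext (m : nat) (a b : nat -> C) (T r : R) :
  (forall l, a l = b l) -> M1_half m a T r = M1_half m b T r.
Proof.
intros H; unfold M1_half; do 2 f_equal.
apply RInt_ext; intros t _; now rewrite (Rm_ext m a b).
Qed.

Lemma M1_ext (m : nat) (a b a' b' : nat -> C) (r : R) :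
  (forall l, a l = a' l) -> (forall l, b l = b' l) ->
  M1 m a b r = M1 m a' b' r.
Proof.
intros Ha Hb; unfold M1.
now rewrite (M1_half_ext m a a'), (M1_half_ext m b b').
Qed.

Lemma reflect_coefK (a : nat -> C) (l : nat) :
  reflect_coef (reflect_coef a) l = a l.
Proof.
unfold reflect_coef; rewrite Cmult_assoc, <- Cpow_mult_l.
replace (-1 * -1)%C with (RtoC 1) by (apply injective_projections; simpl; ring).
now rewrite Cpow_1_l, Cmult_1_l.
Qed.

Lemma simple_zero_ext (F G : R -> R) (r : R) :
  (forall x, F x = G x) -> simple_zero F r -> simple_zero G r.
Proof.
intros H [H01 [H0 [d [Hd Hd0]]]].
split; [exact H01 | split; [now rewrite <- H | ]].
exists d; split; [now apply (is_derive_ext F) | exact Hd0].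
Qed.

Lemma has_simple_zeros_ext (F G : R -> R) (n : nat) :
  (forall x, F x = G x) -> has_simple_zeros F n -> has_simple_zeros G n.
Proof.
intros H [s [Hs [Hl Hr]]]; exists s; split; [exact Hs | split; [exact Hl | ]].
intros r Hi; apply (simple_zero_ext F G r H), Hr, Hi.
Qed.

Lemma realizable_sym (m i j : nat) : realizable m i j -> realizable m j i.
Proof.
intros [ap [am [Hi Hj]]].
exists (reflect_coef am), (reflect_coef ap); split; auto.
refine (has_simple_zeros_ext _ _ _ _ Hi).
intros r; unfold N1; apply M1_ext; intros l; symmetry; apply reflect_coefK.
Qed.

(* Main.v *)
(* Put [w = r e^{- i t}], so that [1 / (1 - phi_inv (conj w)) = (1 + conj w) / 2]: the
   integrands become combinations of [(1 + w)^2 v^j (i e^{i t})] with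
   [v = 1 / (1 + w)], whose primitives are elementary.  Each integral over a half circle
   is a real function of [r], the same for both half circles, plus an imaginary
   multiple of [r] that changes sign with the orientation.
   Hence [M1 / r] has the derivative
     sum_l e_l (q_l(r) + q_l(- r)) / r^2,   q_l(x) = (1 + x)^2 ((x - 1) / (x + 1))^l,
   with real [e_l].  For [m >= 2], multiplying by [r^2 (1 - r^2)^(m-2)] gives an even
   polynomial of degree at most [2 m - 2], which has at most [m - 1] positive roots
   unless it vanishes, so Rolle's theorem bounds the number of simple zeros by [m],
   and [m <= 2 m - 3] for [m >= 3].
   For [m <= 2], [M1] is a quadratic polynomial and [N1(r) = r^2 M1(1/r)], so the zeros
   of both are the positive roots of one quadratic; for [m = 0] the product of its
   roots is [-1].  For [m = 3],
     M1 = A + b r + c r^2 + d r L,   N1 = c + b' r + A r^2 + d r L,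
     L = ln ((1 + r) / (1 - r)),
   with independent [A, b, b', c, d]. *)

Require Import Defs.
From Stdlib Require Import Reals Lra Lia List.
From Coquelicot Require Import Coquelicot.
Open Scope R_scope.

(** * Calculus of complex-valued functions of a real variable *)

Notation is_derive_RC := (is_derive (K := R_AbsRing) (V := C_R_NormedModule)).
Notation is_RInt_C := (is_RInt (V := C_R_NormedModule)).

Lemma is_derive_C_pair (f g : R -> R) (t a b : R) :
  is_derive f t a -> is_derive g t b ->
  is_derive_RC (fun x => (f x, g x)) t (a, b).
Proof.
intros Hf Hg.
apply (filterdiff_comp'_2 f g (fun u v => (u, v)) t _ _ (fun u v => (u, v)) Hf Hg).
apply (filterdiff_linear (fun p : R * R => (fst p, snd p))).
apply is_linear_prod; [apply is_linear_fst | apply is_linear_snd].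
Qed.

Lemma is_derive_C_fst (f : R -> C) (t : R) (d : C) :
  is_derive_RC f t d -> is_derive (fun x => fst (f x)) t (fst d).
Proof.
intros Hf.
apply (filterdiff_comp' f (fun p : R * R => fst p) t _ (fun p => fst p) Hf).
apply filterdiff_linear, is_linear_fst.
Qed.

Lemma is_derive_C_snd (f : R -> C) (t : R) (d : C) :
  is_derive_RC f t d -> is_derive (fun x => snd (f x)) t (snd d).
Proof.
intros Hf.
apply (filterdiff_comp' f (fun p : R * R => snd p) t _ (fun p => snd p) Hf).
apply filterdiff_linear, is_linear_snd.
Qed.

Lemma is_derive_C_mult (f g : R -> C) (t : R) (df dg : C) :
  is_derive_RC f t df -> is_derive_RC g t dg ->
  is_derive_RC (fun x => (f x * g x)%C) t (df * g t + f t * dg)%C.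
Proof.
intros Hf Hg.
pose proof (is_derive_C_fst _ _ _ Hf) as F1.
pose proof (is_derive_C_snd _ _ _ Hf) as F2.
pose proof (is_derive_C_fst _ _ _ Hg) as G1.
pose proof (is_derive_C_snd _ _ _ Hg) as G2.
unfold Cmult.
replace (_ + _)%C with
  (fst df * fst (g t) + fst (f t) * fst dg - (snd df * snd (g t) + snd (f t) * snd dg),
   fst df * snd (g t) + fst (f t) * snd dg + (snd df * fst (g t) + snd (f t) * fst dg))
  by (apply injective_projections; simpl; ring).
apply is_derive_C_pair.
- apply (is_derive_minus (V := R_NormedModule)); apply (is_derive_mult (K := R_AbsRing)); auto; intros; apply Rmult_comm.
- apply (is_derive_plus (V := R_NormedModule)); apply (is_derive_mult (K := R_AbsRing)); auto; intros; apply Rmult_comm.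
Qed.

Lemma sqr_norm_neq_0 (z : C) : z <> 0%C -> fst z ^ 2 + snd z ^ 2 <> 0.
Proof.
intros Hz H; apply Hz, injective_projections; simpl; nra.
Qed.

Lemma is_derive_C_inv (f : R -> C) (t : R) (d : C) :
  is_derive_RC f t d -> f t <> 0%C ->
  is_derive_RC (fun x => (/ f x)%C) t (- (d * (/ f t * / f t)))%C.
Proof.
intros Hf H0.
pose proof (is_derive_C_fst _ _ _ Hf) as F1.
pose proof (is_derive_C_snd _ _ _ Hf) as F2.
pose proof (sqr_norm_neq_0 _ H0) as N0.
unfold Cinv.
set (u := fun x => fst (f x)) in *; set (v := fun x => snd (f x)) in *.
change (fst (f t)) with (u t) in *; change (snd (f t)) with (v t) in *.
assert (Eu : ex_derive u t) by (eexists; exact F1).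
assert (Ev : ex_derive v t) by (eexists; exact F2).
assert (Du : Derive (fun x => u x) t = fst d) by apply is_derive_unique, F1.
assert (Dv : Derive (fun x => v x) t = snd d) by apply is_derive_unique, F2.
(* [D] is the squared modulus of [f t], the denominator of both components of the inverse. *)
pose (D := u t ^ 2 + v t ^ 2).
replace (- _)%C with
  ((fst d * D - u t * (2 * u t * fst d + 2 * v t * snd d)) / D ^ 2,
   (- snd d * D + v t * (2 * u t * fst d + 2 * v t * snd d)) / D ^ 2).
2: { unfold D; apply injective_projections; simpl; field; simpl in N0; lra. }
apply (is_derive_C_pair (fun x => u x / (u x ^ 2 + v x ^ 2))
                        (fun x => - v x / (u x ^ 2 + v x ^ 2))); unfold D.
- auto_derive.
  { simpl in N0; repeat split; auto. }
  rewrite Du, Dv.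
  field; auto.
- auto_derive.
  { simpl in N0; repeat split; auto. }
  rewrite Du, Dv.
  field; auto.
Qed.

Lemma is_derive_C_pow (f : R -> C) (n : nat) (t : R) (d : C) :
  is_derive_RC f t d ->
  is_derive_RC (fun x => (f x ^ S n)%C) t (INR (S n) * (f t ^ n * d))%C.
Proof.
intros Hf; induction n as [|n IH].
- apply (is_derive_ext f); [intros x; symmetry; apply Cpow_1_r | ].
  replace (_ * _)%C with d by (simpl; ring). exact Hf.
- apply (is_derive_ext (fun x => (f x * f x ^ S n)%C)); [reflexivity | ].
  replace (INR (S (S n)) * _)%C
    with (d * f t ^ S n + f t * (INR (S n) * (f t ^ n * d)))%C
    by (rewrite (S_INR (S n)), RtoC_plus, Cpow_S; ring).
  now apply is_derive_C_mult.
Qed.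

Lemma is_RInt_C_pair (f : R -> C) (a b x y : R) :
  is_RInt (fun t => fst (f t)) a b x -> is_RInt (fun t => snd (f t)) a b y ->
  is_RInt_C f a b (x, y).
Proof. apply (is_RInt_fct_extend_pair (U := R_NormedModule) (V := R_NormedModule)). Qed.

Lemma is_RInt_C_eq (f g : R -> C) (a b : R) (l k : C) :
  is_RInt_C f a b l -> (forall t, f t = g t) -> l = k -> is_RInt_C g a b k.
Proof. intros H E <-; now apply (is_RInt_ext f); [intros t _; apply E | ]. Qed.

Lemma is_RInt_C_plus (f g : R -> C) (a b : R) (l k : C) :
  is_RInt_C f a b l -> is_RInt_C g a b k ->
  is_RInt_C (fun t => (f t + g t)%C) a b (l + k)%C.
Proof. apply (is_RInt_plus (V := C_R_NormedModule)). Qed.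

Lemma is_RInt_C_minus (f g : R -> C) (a b : R) (l k : C) :
  is_RInt_C f a b l -> is_RInt_C g a b k ->
  is_RInt_C (fun t => (f t - g t)%C) a b (l - k)%C.
Proof. apply (is_RInt_minus (V := C_R_NormedModule)). Qed.

(** The module structure is over the reals, so a complex constant is moved out component by
    component. *)
Lemma is_RInt_C_mult_l (f : R -> C) (a b : R) (c l : C) :
  is_RInt_C f a b l -> is_RInt_C (fun t => (c * f t)%C) a b (c * l)%C.
Proof.
intros H.
pose proof (is_RInt_fct_extend_fst (U := R_NormedModule) (V := R_NormedModule) _ _ _ _ H) as H1.
pose proof (is_RInt_fct_extend_snd (U := R_NormedModule) (V := R_NormedModule) _ _ _ _ H) as H2.
apply is_RInt_C_pair; simpl.
- apply (is_RInt_minus (V := R_NormedModule)); now apply (is_RInt_scal (V := R_NormedModule)).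
- apply (is_RInt_plus (V := R_NormedModule)); now apply (is_RInt_scal (V := R_NormedModule)).
Qed.

Lemma is_RInt_C_FTC (f df : R -> C) (a b : R) :
  (forall t, is_derive_RC f t (df t)) ->
  (forall t, ex_derive (K := R_AbsRing) (V := C_R_NormedModule) df t) ->
  is_RInt_C df a b (f b - f a)%C.
Proof.
intros Hf Hd.
apply (is_RInt_derive (V := C_R_CompleteNormedModule) f df); intros t _; [apply Hf | ].
apply (ex_derive_continuous (V := C_R_NormedModule)), Hd.
Qed.

(** * The complex derivative of [phi] *)

Lemma phi_slope (x z : C) :
  (1 - x)%C <> 0%C -> (1 - z)%C <> 0%C -> (x - z)%C <> 0%C ->
  ((phi x - phi z) / (x - z))%C = (2 / ((1 - x) * (1 - z)))%C.
Proof. intros Hx Hz Hxz; unfold phi; field; auto. Qed.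

(** [C_lim] approaches [z] along the horizontal line through it. There the difference quotient
    agrees near [z] with the simplified slope [F], which is continuous at [fst z]. *)
Lemma C_derive_phi (z : C) : z <> 1%C -> C_derive phi z = (2 / (1 - z) ^ 2)%C.
Proof.
intros Hz.
assert (Hz' : (1 - z)%C <> 0%C).
{ intros H; apply Hz. replace z with (1 - (1 - z))%C by ring. rewrite H; ring. }
pose (F := fun x : R => (2 / ((1 - (x, snd z)) * (1 - z)))%C).
assert (FC : continuous (U := C_R_NormedModule) F (fst z)).
{ apply (ex_derive_continuous (K := R_AbsRing) (V := C_R_NormedModule)).
  eexists; unfold F, Cdiv.
  apply (is_derive_C_mult (fun _ => RtoC 2) (fun x => (/ ((1 - (x, snd z)) * (1 - z)))%C)).
  { apply is_derive_const. }
  apply is_derive_C_inv.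
  2: { rewrite <- surjective_pairing; now apply Cmult_neq_0. }
  apply (is_derive_C_mult (fun x => (1 - (x, snd z))%C) (fun _ => (1 - z)%C)).
  2: apply is_derive_const.
  apply (is_derive_minus (V := C_R_NormedModule)).
  { apply is_derive_const. }
  apply is_derive_C_pair; [apply is_derive_id | apply is_derive_const]. }
assert (HF : F (fst z) = (2 / (1 - z) ^ 2)%C).
{ unfold F; rewrite <- surjective_pairing; simpl; field; auto. }
(* Within this radius the horizontal line avoids the pole: [(x, snd z) = 1] would put [x] at
   distance exactly [Cmod (1 - z)] from [fst z]. *)
assert (Hpos : 0 < Cmod (1 - z)) by now apply Cmod_gt_0.
assert (Hloc : forall x, ball (fst z) (mkposreal _ Hpos) x -> x <> fst z ->
          F x = ((phi (x, snd z) - phi z) / ((x, snd z) - z))%C).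
{ intros x Hb Hx.
  assert (Hxz : ((x, snd z) - z)%C <> 0%C).
  { intros H; apply (f_equal fst) in H; simpl in H; lra. }
  assert (Hx1 : (1 - (x, snd z))%C <> 0%C).
  { intros H.
    assert (E : (1 - z)%C = RtoC (x - fst z)).
    { replace (1 - z)%C with ((1 - (x, snd z)) + ((x, snd z) - z))%C by ring.
      rewrite H; apply injective_projections; simpl; ring. }
    revert Hb; unfold ball; simpl; unfold AbsRing_ball; simpl.
    rewrite E, Cmod_R; unfold abs, minus, plus, opp; simpl; unfold Rminus; lra. }
  now symmetry; apply phi_slope. }
unfold C_derive, C_lim; rewrite <- HF.
apply injective_projections; cbn [fst snd].
- apply (f_equal real (y := Finite (fst (F (fst z))))), is_lim_unique.
  apply (is_lim_ext_loc (fun x => fst (F x))).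
  { exists (mkposreal _ Hpos); intros x Hb Hx; now rewrite (Hloc x Hb Hx). }
  apply is_lim_continuity, continuity_pt_filterlim.
  apply (continuous_comp F fst); [exact FC | apply continuous_fst].
- apply (f_equal real (y := Finite (snd (F (fst z))))), is_lim_unique.
  apply (is_lim_ext_loc (fun x => snd (F x))).
  { exists (mkposreal _ Hpos); intros x Hb Hx; now rewrite (Hloc x Hb Hx). }
  apply is_lim_continuity, continuity_pt_filterlim.
  apply (continuous_comp F snd); [exact FC | apply continuous_snd].
Qed.

(** * The integrals over the half circles *)

(** [wbar] and [vbar] are the [w] and [v] of the header. *)
Definition wbar (r t : R) : C := Cconj (r * expi t).

Definition vbar (r t : R) : C := (/ (1 + wbar r t))%C.

Lemma is_derive_expi (t : R) : is_derive_RC expi t (Ci * expi t)%C.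
Proof.
replace (Ci * expi t)%C with (- sin t, cos t)
  by (apply injective_projections; simpl; ring).
apply is_derive_C_pair; [apply is_derive_cos | apply is_derive_sin].
Qed.

Lemma is_derive_wbar (r t : R) : is_derive_RC (wbar r) t (- (Ci * wbar r t))%C.
Proof.
apply (is_derive_ext (V := C_R_NormedModule) (fun x => (r * cos x, - (r * sin x)))).
{ intros x; apply injective_projections; simpl; ring. }
replace (- _)%C with (- (r * sin t), - (r * cos t))
  by (apply injective_projections; simpl; ring).
apply is_derive_C_pair; auto_derive; auto; ring.
Qed.

Lemma wbar_pos (r t : R) : 0 < r < 1 -> 0 < fst (1 + wbar r t)%C.
Proof.
intros Hr; simpl; pose proof (COS_bound t); nra.
Qed.

Lemma wbar_neq (r t : R) : 0 < r < 1 -> (1 + wbar r t)%C <> 0%C.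
Proof. intros Hr H; apply (wbar_pos r t) in Hr; rewrite H in Hr; simpl in Hr; lra. Qed.

Lemma is_derive_vbar (r t : R) : 0 < r < 1 ->
  is_derive_RC (vbar r) t (Ci * wbar r t * (vbar r t * vbar r t))%C.
Proof.
intros Hr.
replace (_ * _)%C with (- ((0 + - (Ci * wbar r t)) * (vbar r t * vbar r t)))%C by ring.
apply (is_derive_C_inv (fun x => (1 + wbar r x)%C)); [ | now apply wbar_neq].
apply (is_derive_plus (V := C_R_NormedModule)); [ | apply is_derive_wbar].
apply (is_derive_const (K := R_AbsRing) (V := C_R_NormedModule) (RtoC 1)).
Qed.

(* [log (1 + wbar r t)], the half-plane [0 < Re] being free of branch cuts. *)
Lemma is_derive_log_wbar (r t : R) : 0 < r < 1 ->
  is_derive_RC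
    (fun t => (ln ((1 + r * cos t) ^ 2 + (r * sin t) ^ 2) / 2,
               - atan (r * sin t / (1 + r * cos t)))) t
    (- (vbar r t * (Ci * wbar r t)))%C.
Proof.
intros Hr.
pose proof (wbar_pos r t Hr) as Hp; simpl in Hp.
replace (1 + (r * cos t - 0 * sin t)) with (1 + r * cos t) in Hp by ring.
assert (HN : 0 < (1 + r * cos t) ^ 2 + (r * sin t) ^ 2) by nra.
assert (HN' : 0 < (1 + r * cos t) ^ 2) by nra.
replace (- _)%C with
  (- (r * sin t) / ((1 + r * cos t) ^ 2 + (r * sin t) ^ 2),
   - (r * cos t + r ^ 2 * ((cos t) ^ 2 + (sin t) ^ 2)) / ((1 + r * cos t) ^ 2 + (r * sin t) ^ 2)).
2: { apply injective_projections; simpl; field; simpl in HN; lra. }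
apply is_derive_C_pair.
- auto_derive; [repeat split; simpl in HN; lra | ].
  simpl in HN; field; lra.
- auto_derive; [repeat split; lra | ].
  field; simpl in HN; repeat split; try lra; nra.
Qed.

(** The integral of v^(j+1) (i w) over either half circle, see [is_RInt_vbar_pow]; only j = 0
    produces logarithms. *)
Definition kap_step (j : nat) (r : R) : R :=
  match j with
  | O => ln (1 + r) - ln (1 - r)
  | S _ => (/ (1 - r) ^ j - / (1 + r) ^ j) / INR j
  end.

(* [- r * kap j r] is the real part of the integral of [v^j (i r)] over either half
   circle, see [is_RInt_vbar_pow_const]. *)
Fixpoint kap (j : nat) (r : R) : R :=
  match j with O => 0 | S i => kap i r + kap_step i r end.

Lemma ex_derive_vbar_pow (r t : R) (n : nat) : 0 < r < 1 ->
  exists d, is_derive_RC (fun t => (vbar r t ^ n)%C) t d.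
Proof.
intros Hr; destruct n as [|n].
- eexists; simpl; apply (is_derive_const (K := R_AbsRing) (V := C_R_NormedModule)).
- eexists; apply is_derive_C_pow; now apply is_derive_vbar.
Qed.

(** The hypothesis [expi T = -1], here and below, treats [T = PI] and [T = - PI] at once. *)
Lemma half_turn_wbar (r T : R) : expi T = (-1)%C -> wbar r T = RtoC (- r).
Proof. intros H; unfold wbar; rewrite H; apply injective_projections; simpl; ring. Qed.

Lemma wbar_0 (r : R) : wbar r 0 = RtoC r.
Proof.
unfold wbar, expi; rewrite cos_0, sin_0; apply injective_projections; simpl; ring.
Qed.

(** Since v' = i w v^2, a primitive is v^j / j for j > 0, and - log (1 + w) for j = 0. At the
    endpoints 1 + w is 1 + r and 1 - r, so the value is real and the same for both half circles. *)
Lemma is_RInt_vbar_pow (j : nat) (r T : R) : 0 < r < 1 -> expi T = (-1)%C ->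
  is_RInt_C (fun t => (vbar r t ^ S j * (Ci * wbar r t))%C) 0 T (RtoC (kap_step j r)).
Proof.
intros Hr HT.
assert (Hex : forall t, ex_derive (K := R_AbsRing) (V := C_R_NormedModule)
                (fun t => (vbar r t ^ S j * (Ci * wbar r t))%C) t).
{ intros t; destruct (ex_derive_vbar_pow r t (S j) Hr) as [d Hd].
  eexists; apply is_derive_C_mult; [exact Hd | ].
  apply is_derive_C_mult; [ | apply is_derive_wbar].
  apply (is_derive_const (K := R_AbsRing) (V := C_R_NormedModule)). }
destruct j as [|j].
- set (F := fun t => (ln ((1 + r * cos t) ^ 2 + (r * sin t) ^ 2) / 2,
               - atan (r * sin t / (1 + r * cos t))) : C).
  replace (RtoC (kap_step 0 r)) with (-1 * F T - -1 * F 0)%C.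
  + apply (is_RInt_C_FTC (fun t => (-1 * F t)%C)); [ | exact Hex].
    intros t.
    replace (_ * _)%C with (0 * F t + -1 * - (vbar r t * (Ci * wbar r t)))%C by (simpl; ring).
    apply (is_derive_C_mult (fun _ => (-1)%C) F); [ | now apply is_derive_log_wbar].
    apply (is_derive_const (K := R_AbsRing) (V := C_R_NormedModule) (RtoC (-1))).
  + injection HT; intros Hs Hc.
    unfold F; rewrite Hs, Hc, cos_0, sin_0.
    replace ((1 + r * -1) ^ 2 + (r * 0) ^ 2) with ((1 - r) ^ 2) by ring.
    replace ((1 + r * 1) ^ 2 + (r * 0) ^ 2) with ((1 + r) ^ 2) by ring.
    replace (r * 0 / (1 + r * -1)) with 0 by (field; lra).
    replace (r * 0 / (1 + r * 1)) with 0 by (field; lra).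
    rewrite atan_0, !ln_pow by lra.
    apply injective_projections; simpl; field.
- replace (RtoC (kap_step (S j) r))
    with (/ INR (S j) * vbar r T ^ S j - / INR (S j) * vbar r 0 ^ S j)%C.
  + apply (is_RInt_C_FTC (fun t => (/ INR (S j) * vbar r t ^ S j)%C)); [ | exact Hex].
    intros t.
    replace (_ * _)%C with (0 * vbar r t ^ S j + / INR (S j) *
        (INR (S j) * (vbar r t ^ j * (Ci * wbar r t * (vbar r t * vbar r t)))))%C.
    * apply (is_derive_C_mult (fun _ => (/ INR (S j))%C)); [ | now apply is_derive_C_pow, is_derive_vbar].
      apply (is_derive_const (K := R_AbsRing) (V := C_R_NormedModule) (/ INR (S j))%C).
    * rewrite !Cpow_S; field.
      intros H; apply RtoC_inj in H; revert H; apply not_0_INR; lia.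
  + unfold vbar; rewrite wbar_0, half_turn_wbar by exact HT.
    assert (Hj : INR (S j) <> 0) by (apply not_0_INR; lia).
    rewrite <- !RtoC_plus, <- !RtoC_inv, <- !RtoC_pow, <- !RtoC_mult, <- RtoC_minus by lra.
    f_equal; unfold kap_step; rewrite !pow_inv.
    replace (1 + - r) with (1 - r) by ring.
    unfold Rdiv; ring.
Qed.

(** From v w = 1 - v comes v^(j+1) = v^j - w v^(j+1), and the integral of the last term is real. The
    imaginary part [T * r] is therefore inherited from j = 0. *)
Lemma is_RInt_vbar_pow_const (j : nat) (r T : R) : 0 < r < 1 -> expi T = (-1)%C ->
  is_RInt_C (fun t => (vbar r t ^ j * (Ci * r))%C) 0 T (- (r * kap j r), T * r).
Proof.
intros Hr HT; induction j as [|j IH].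
- eapply is_RInt_C_eq.
  + apply (is_RInt_const (V := C_R_NormedModule) 0 T (Ci * r)%C).
  + intros t; simpl; ring.
  + apply injective_projections; simpl; unfold scal; simpl; unfold mult; simpl; ring.
- eapply is_RInt_C_eq.
  + apply is_RInt_C_minus; [exact IH | ].
    exact (is_RInt_C_mult_l _ _ _ r _ (is_RInt_vbar_pow j r T Hr HT)).
  + intros t; rewrite !Cpow_S.
    assert (E : (vbar r t * wbar r t = 1 - vbar r t)%C).
    { pose proof (wbar_neq r t Hr); unfold vbar; field; auto. }
    transitivity (vbar r t ^ j * (Ci * r) - r * (vbar r t ^ j * Ci * (vbar r t * wbar r t)))%C;
      [ring | ].
    rewrite E; ring.
  + apply injective_projections; simpl; ring.
Qed.

(* The real part of the integral of [(1 + w)^2 v^j (i e^{i t})]; the recursion comes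
   from [v^j - v^(j+1) = w v^(j+1)] and [w e^{i t} = r]. *)
Fixpoint rho (j : nat) (r : R) : R :=
  match j with
  | O => -2 + 2 * r ^ 2
  | S O => -2
  | S (S k as i) => rho i r + r * kap k r
  end.

Lemma wbar_expi (r t : R) : (wbar r t * expi t)%C = RtoC r.
Proof.
pose proof (sin2_cos2 t) as H; unfold Rsqr in H.
apply injective_projections; simpl; [ | ring].
transitivity (r * (sin t * sin t + cos t * cos t)); [ring | rewrite H; ring].
Qed.

Lemma is_RInt_Ci_expi (T : R) : expi T = (-1)%C ->
  is_RInt_C (fun t => (Ci * expi t)%C) 0 T (-2, 0).
Proof.
intros HT.
replace (-2, 0) with (expi T - expi 0)%C.
- apply is_RInt_C_FTC; [apply is_derive_expi | intros t].
  eexists; apply (is_derive_C_mult (fun _ => Ci)); [ | apply is_derive_expi].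
  apply (is_derive_const (K := R_AbsRing) (V := C_R_NormedModule)).
- rewrite HT; unfold expi; rewrite cos_0, sin_0.
  apply injective_projections; simpl; ring.
Qed.

Lemma is_RInt_wbar_const (r T : R) : expi T = (-1)%C ->
  is_RInt_C (fun t => (wbar r t * (Ci * r))%C) 0 T (2 * r ^ 2, 0).
Proof.
intros HT.
replace (2 * r ^ 2, 0) with (- r * wbar r T - - r * wbar r 0)%C.
- apply (is_RInt_C_FTC (fun t => (- r * wbar r t)%C)); intros t.
  + replace (_ * _)%C with (0 * wbar r t + - r * - (Ci * wbar r t))%C by ring.
    apply (is_derive_C_mult (fun _ => (- r)%C)); [ | apply is_derive_wbar].
    apply (is_derive_const (K := R_AbsRing) (V := C_R_NormedModule)).
  + eexists; apply is_derive_C_mult; [apply is_derive_wbar | ].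
    apply (is_derive_const (K := R_AbsRing) (V := C_R_NormedModule)).
- rewrite wbar_0, half_turn_wbar by exact HT.
  apply injective_projections; simpl; ring.
Qed.

(** By (1 + w) v = 1 and w e^{i t} = r, the integrands for j + 1 and j + 2 differ by v^j (i r),
    whose integral has imaginary part [T * r]. The cases j = 0, 1 are integrated directly. *)
Lemma is_RInt_rho (j : nat) (r T : R) : 0 < r < 1 -> expi T = (-1)%C ->
  is_RInt_C (fun t => ((1 + wbar r t) ^ 2 * vbar r t ^ j * (Ci * expi t))%C) 0 T
    (rho j r, T * r * (2 - INR j)).
Proof.
intros Hr HT.
pose proof (fun k => is_RInt_vbar_pow_const k r T Hr HT) as HK.
assert (HV : forall t, (vbar r t * (1 + wbar r t) = 1)%C).
{ intros t; apply Cinv_l; now apply wbar_neq. }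
assert (H1 : is_RInt_C (fun t => ((1 + wbar r t) * (Ci * expi t))%C) 0 T (-2, T * r)).
{ eapply is_RInt_C_eq.
  - apply is_RInt_C_plus; [now apply is_RInt_Ci_expi | apply (HK 0%nat)].
  - intros t.
    transitivity (Ci * expi t + Ci * (wbar r t * expi t))%C; [ | ring].
    rewrite wbar_expi; simpl; ring.
  - apply injective_projections; simpl; ring. }
destruct j as [|j].
{ eapply is_RInt_C_eq.
  - apply is_RInt_C_plus; [exact H1 | ].
    apply is_RInt_C_plus; [apply (HK 0%nat) | now apply (is_RInt_wbar_const r)].
  - intros t; simpl.
    transitivity ((1 + wbar r t) * (Ci * expi t)
                  + Ci * (wbar r t * expi t) * (1 + wbar r t))%C; [ | ring].
    rewrite wbar_expi; ring.
  - apply injective_projections; simpl; ring. }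
induction j as [|j IH].
{ eapply is_RInt_C_eq; [exact H1 | | apply injective_projections; simpl; ring].
  intros t; simpl.
  transitivity ((1 + wbar r t) * (Ci * expi t) * (vbar r t * (1 + wbar r t)))%C; [ | ring].
  rewrite HV; ring. }
eapply is_RInt_C_eq; [apply is_RInt_C_minus; [exact IH | apply (HK j)] | | ].
- intros t; set (w := wbar r t); set (v := vbar r t).
  assert (E : (v - v * v * w = v * v)%C).
  { transitivity (v * (v * (1 + w)) - v * v * w)%C; [ | ring].
    unfold v, w; rewrite HV; ring. }
  transitivity ((1 + w) ^ 2 * v ^ S j * (Ci * expi t)
    - (v * (1 + w)) * (v * (1 + w)) * v ^ j * (Ci * (w * expi t)))%C.
  + unfold v, w; rewrite HV, wbar_expi; ring.
  + transitivity ((1 + w) ^ 2 * v ^ j * (Ci * expi t) * (v - v * v * w))%C;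
      [ | rewrite E]; rewrite !Cpow_S; ring.
- apply injective_projections; cbn [fst snd rho Cminus Cplus Copp]; rewrite ?S_INR; ring.
Qed.

(* What a linear functional does to [v^j (1 - 2 v)^l] if it maps [v^i] to [f i]. *)
Fixpoint twist (f : nat -> R) (l j : nat) : R :=
  match l with O => f j | S k => twist f k j - 2 * twist f k (S j) end.

(** The factor 1 - 2 v is the conjugate of [phi_inv (r * expi t)], so j = 0 handles the monomial z^l
    of the perturbation; general j carries the induction on l. *)
Lemma is_RInt_twist (l j : nat) (r T : R) : 0 < r < 1 -> expi T = (-1)%C ->
  is_RInt_C (fun t => ((1 + wbar r t) ^ 2 * vbar r t ^ j
                        * (1 - 2 * vbar r t) ^ l * (Ci * expi t))%C) 0 T
    (twist (fun i => rho i r) l j, T * r * twist (fun i => 2 - INR i) l j).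
Proof.
intros Hr HT; revert j; induction l as [|l IH]; intros j.
- eapply is_RInt_C_eq; [now apply (is_RInt_rho j) | intros t; simpl; ring | reflexivity].
- eapply is_RInt_C_eq.
  + apply is_RInt_C_minus; [apply (IH j) | exact (is_RInt_C_mult_l _ _ _ 2 _ (IH (S j)))].
  + intros t; simpl; ring.
  + apply injective_projections; simpl; ring.
Qed.

Lemma Cconj_sum_n (f : nat -> C) (n : nat) :
  Cconj (sum_n f n) = sum_n (fun l => Cconj (f l)) n.
Proof.
induction n as [|n IH]; [now rewrite !sum_O | rewrite !sum_Sn].
rewrite <- IH; apply Cplus_conj.
Qed.

Lemma Cmult_sum_n (c : C) (f : nat -> C) (n : nat) :
  (c * sum_n f n)%C = sum_n (fun l => c * f l)%C n.
Proof.
induction n as [|n IH]; [now rewrite !sum_O | rewrite !sum_Sn].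
rewrite <- IH; apply Cmult_plus_distr_l.
Qed.

Lemma is_RInt_C_sum_n (f : nat -> R -> C) (a b : R) (l : nat -> C) (n : nat) :
  (forall k, is_RInt_C (f k) a b (l k)) ->
  is_RInt_C (fun t => sum_n (fun k => f k t) n) a b (sum_n l n).
Proof.
intros H; induction n as [|n IH].
- eapply is_RInt_C_eq; [apply (H 0%nat) | intros t | ]; now rewrite sum_O.
- eapply is_RInt_C_eq; [apply (is_RInt_C_plus _ _ _ _ _ _ IH (H (S n))) | intros t | ];
    now rewrite sum_Sn.
Qed.

(** With W = r e^{i t}, [phi_inv] gives z = 1 - 2 / (1 + W), hence phi'(z) = 2 / (1 - z)^2 = (1 +
    W)^2 / 2. Conjugation turns W into w and restores the coefficients [a l]. *)
Lemma M1_integrand (m : nat) (a : nat -> C) (r t : R) : 0 < r < 1 ->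
  (Cconj (C_derive phi (phi_inv (r * expi t)) * Rm m a (phi_inv (r * expi t)))
     * (Ci * expi t))%C
  = sum_n (fun l => a l * / 2 * ((1 + wbar r t) ^ 2 * vbar r t ^ 0
                                 * (1 - 2 * vbar r t) ^ l * (Ci * expi t)))%C m.
Proof.
intros Hr.
assert (HW : (1 + r * expi t)%C <> 0%C).
{ intros H; apply (wbar_neq r t Hr).
  replace (1 + wbar r t)%C with (Cconj (1 + r * expi t))
    by (apply injective_projections; simpl; ring).
  rewrite H; apply injective_projections; simpl; ring. }
assert (H2 : RtoC 2 <> 0%C) by (intros H; apply RtoC_inj in H; lra).
assert (Hz : phi_inv (r * expi t) = (1 - 2 * / (1 + r * expi t))%C).
{ assert (HW' : (r * expi t + 1)%C <> 0%C) by now rewrite Cplus_comm.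
  unfold phi_inv; field; auto. }
assert (HR : forall x : R, Cconj (RtoC x) = RtoC x)
  by (intros x; apply injective_projections; simpl; ring).
assert (Hw : Cconj (1 + r * expi t) = (1 + wbar r t)%C) by now rewrite Cplus_conj, HR.
assert (Hv : Cconj (1 - 2 * / (1 + r * expi t)) = (1 - 2 * vbar r t)%C).
{ rewrite Cminus_conj, Cmult_conj, Cinv_conj, Hw, !HR; auto. }
rewrite C_derive_phi, Hz.
2: { rewrite Hz; intros H; apply H2.
     transitivity ((1 - (1 - 2 * / (1 + r * expi t))) * (1 + r * expi t))%C; [field; auto | ].
     rewrite H; ring. }
replace (1 - (1 - 2 * / (1 + r * expi t)))%C with (2 * / (1 + r * expi t))%C by ring.
replace (2 / _)%C with (/ 2 * (1 + r * expi t) ^ 2)%C by (field; auto).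
unfold Rm; rewrite Cmult_conj, Cconj_sum_n.
rewrite <- Cmult_assoc, (Cmult_comm (sum_n _ _)), Cmult_assoc, Cmult_sum_n.
apply sum_n_ext; intros l.
rewrite !Cmult_conj, !Cpow_conj, Cconj_conj, Hw, Hv.
rewrite Cinv_conj, HR by auto.
simpl; ring.
Qed.

(* The integral of the [l]-th summand splits into a part that is the same for
   both half circles and a multiple of [r] that changes sign with [T]. *)
Lemma M1_half_eq (m : nat) (a : nat -> C) (T r : R) : 0 < r < 1 -> expi T = (-1)%C ->
  M1_half m a T r =
  sum_n (fun l => - (Im (a l) / 2) * twist (fun i => rho i r) l 0
                  - T / 2 * Re (a l) * twist (fun i => 2 - INR i) l 0 * r) m.
Proof.
intros Hr HT; unfold M1_half.
rewrite (is_RInt_unique (V := C_R_CompleteNormedModule) _ 0 T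
  (sum_n (fun l => a l * / 2 * (twist (fun i => rho i r) l 0,
                                (T * r * twist (fun i => 2 - INR i) l 0)%R))%C m)).
- clear Hr; induction m as [|m IH]; [rewrite !sum_O | rewrite !sum_Sn].
  + unfold Im, Re; simpl; field.
  + rewrite <- IH; unfold plus, Im, Re; simpl; field.
- eapply is_RInt_C_eq; cycle 1.
  + intros t; symmetry; now apply M1_integrand.
  + reflexivity.
  + apply is_RInt_C_sum_n; intros l; apply is_RInt_C_mult_l; now apply is_RInt_twist.
Qed.

Lemma expi_PI : expi PI = (-1)%C.
Proof. unfold expi; rewrite cos_PI, sin_PI; apply injective_projections; simpl; ring. Qed.

Lemma expi_opp_PI : expi (- PI) = (-1)%C.
Proof.
unfold expi; rewrite cos_neg, sin_neg, cos_PI, sin_PI.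
apply injective_projections; simpl; ring.
Qed.

(** In the difference of the two halves, the part common to both half circles retains [ap l - am l],
    and the part odd in [T] retains [ap l + am l]. *)
Lemma M1_eq (m : nat) (ap am : nat -> C) (r : R) : 0 < r < 1 ->
  M1 m ap am r =
  sum_n (fun l => - (Im (ap l - am l) / 2) * twist (fun i => rho i r) l 0) m
  - PI / 2 * sum_n (fun l => Re (ap l + am l) * twist (fun i => 2 - INR i) l 0) m * r.
Proof.
intros Hr; unfold M1.
rewrite !M1_half_eq by (auto using expi_PI, expi_opp_PI).
induction m as [|m IH]; [rewrite !sum_O | rewrite !sum_Sn].
- unfold Im, Re; simpl; field.
- revert IH; unfold plus, Im, Re; simpl; lra.
Qed.

(** * The derivative of M1(r) / r *)

Lemma is_derive_kap (j : nat) (r : R) : 0 < r < 1 ->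
  is_derive (kap j) r ((/ (1 - r) ^ j - / (1 + r) ^ j) / r).
Proof.
intros Hr; induction j as [|j IH].
- replace (_ / r) with 0 by (simpl; field; lra).
  apply (is_derive_const (K := R_AbsRing) (V := R_NormedModule)).
- pose proof (pow_lt (1 - r) j ltac:(lra)) as Hm.
  pose proof (pow_lt (1 + r) j ltac:(lra)) as Hp.
  (* The added term is the derivative of [kap_step j], also in the logarithmic case; the sum over j
     is geometric. *)
  replace (_ / r) with ((/ (1 - r) ^ j - / (1 + r) ^ j) / r
                        + (/ (1 - r) ^ S j + / (1 + r) ^ S j))
    by (simpl; field; repeat split; lra).
  apply (is_derive_plus (V := R_NormedModule)); [exact IH | ].
  destruct j as [|j]; unfold kap_step.
  + auto_derive; [lra | simpl; field; lra].
  + pose proof (not_0_INR (S j) ltac:(lia)) as Hj.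
    pose proof (pow_lt (1 - r) j ltac:(lra)) as Hm'.
    pose proof (pow_lt (1 + r) j ltac:(lra)) as Hp'.
    auto_derive; change (1 + - r) with (1 - r).
    { simpl in Hm, Hp; repeat split; lra. }
    change (match j with 0%nat => 1 | S _ => INR j + 1 end) with (INR (S j)).
    simpl pow; field; repeat split; lra.
Qed.

(** Division by r frees [kap j] from its factor r in the recursion of [rho], so differentiation
    removes the logarithm. *)
Lemma is_derive_rho_div (j : nat) (r : R) : 0 < r < 1 ->
  is_derive (fun r => rho j r / r) r
    (((1 + r) ^ 2 * (/ (1 + r)) ^ j + (1 - r) ^ 2 * (/ (1 - r)) ^ j) / r ^ 2).
Proof.
intros Hr; destruct j as [|j].
{ unfold rho; auto_derive; [lra | simpl; field; lra]. }
induction j as [|j IH].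
{ unfold rho; auto_derive; [lra | simpl; field; lra]. }
pose proof (pow_lt (1 - r) j ltac:(lra)) as Hm.
pose proof (pow_lt (1 + r) j ltac:(lra)) as Hp.
apply (is_derive_ext_loc (fun r => rho (S j) r / r + kap j r)).
{ apply (locally_interval _ _ 0 1); simpl; try lra.
  intros x H0 _; cbn [rho]; field; lra. }
replace (_ / _) with
  (((1 + r) ^ 2 * (/ (1 + r)) ^ S j + (1 - r) ^ 2 * (/ (1 - r)) ^ S j) / r ^ 2
   + (/ (1 - r) ^ j - / (1 + r) ^ j) / r)
  by (rewrite !pow_inv; simpl; field; repeat split; lra).
apply (is_derive_plus (V := R_NormedModule)); [exact IH | now apply is_derive_kap].
Qed.

Lemma is_derive_twist_div (F : nat -> R -> R) (D : nat -> R) (r : R) (l j : nat) :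
  (forall i, is_derive (fun x => F i x / x) r (D i)) ->
  is_derive (fun x => twist (fun i => F i x) l j / x) r (twist D l j).
Proof.
intros H; revert j; induction l as [|l IH]; intros j; [apply H | ].
apply (is_derive_ext (fun x => twist (fun i => F i x) l j / x
                              - 2 * (twist (fun i => F i x) l (S j) / x))).
{ intros x; simpl; unfold Rdiv; ring. }
apply (is_derive_minus (V := R_NormedModule)); [apply IH | ].
apply is_derive_scal, IH.
Qed.

Lemma twist_geometric (c y d z : R) (l j : nat) :
  twist (fun i => c * y ^ i + d * z ^ i) l j =
  c * y ^ j * (1 - 2 * y) ^ l + d * z ^ j * (1 - 2 * z) ^ l.
Proof. revert j; induction l as [|l IH]; intros j; simpl; rewrite ?IH; simpl; ring. Qed.

(** By [is_derive_rho_div] the derivatives are combinations of two geometric sequences, on which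
    [twist] multiplies by (1 - 2 y)^l with y = 1 / (1 + r) or 1 / (1 - r). This is (q_l(r) + q_l(-
    r)) / r^2 in the header's notation. *)
Lemma is_derive_twist_rho (l : nat) (r : R) : 0 < r < 1 ->
  is_derive (fun x => twist (fun i => rho i x) l 0 / x) r
    (((1 + r) ^ 2 * (1 - 2 * / (1 + r)) ^ l
      + (1 - r) ^ 2 * (1 - 2 * / (1 - r)) ^ l) / r ^ 2).
Proof.
intros Hr.
replace (_ / _) with
  (twist (fun i => ((1 + r) ^ 2 / r ^ 2) * (/ (1 + r)) ^ i
                   + ((1 - r) ^ 2 / r ^ 2) * (/ (1 - r)) ^ i) l 0)
  by (rewrite twist_geometric; simpl; field; lra).
apply is_derive_twist_div; intros i.
replace (_ + _) with
  (((1 + r) ^ 2 * (/ (1 + r)) ^ i + (1 - r) ^ 2 * (/ (1 - r)) ^ i) / r ^ 2)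
  by (field; lra).
now apply is_derive_rho_div.
Qed.

(** * Counting zeros *)

(** Polynomial functions of degree at most n in Horner form, which suits induction on the degree
    bound. *)
Fixpoint poly_le (n : nat) (f : R -> R) : Prop :=
  match n with
  | O => exists c, forall x, f x = c
  | S n => exists c g, poly_le n g /\ forall x, f x = c + x * g x
  end.

Lemma poly_le_ext (n : nat) (f g : R -> R) :
  (forall x, f x = g x) -> poly_le n f -> poly_le n g.
Proof.
intros E; destruct n as [|n].
- intros [c Hc]; exists c; intros x; now rewrite <- E.
- intros [c [h [Hh Hc]]]; exists c, h; split; [exact Hh | ].
  intros x; now rewrite <- E.
Qed.

Lemma poly_le_const (n : nat) (c : R) : poly_le n (fun _ => c).
Proof.
revert c; induction n as [|n IH]; intros c; [now exists c | ].
exists c, (fun _ => 0); split; [apply IH | intros x; ring].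
Qed.

Lemma poly_le_S (n : nat) (f : R -> R) : poly_le n f -> poly_le (S n) f.
Proof.
revert f; induction n as [|n IH]; intros f.
- intros [c Hc]; exists c, (fun _ => 0); split; [now exists 0 | ].
  intros x; rewrite Hc; ring.
- intros [c [g [Hg Hc]]]; exists c, g; split; [now apply IH | exact Hc].
Qed.

Lemma poly_le_lin (n : nat) (u v : R) (f g : R -> R) :
  poly_le n f -> poly_le n g -> poly_le n (fun x => u * f x + v * g x).
Proof.
revert f g; induction n as [|n IH]; intros f g.
- intros [c Hc] [d Hd]; exists (u * c + v * d); intros x; now rewrite Hc, Hd.
- intros [c [f' [Hf Hc]]] [d [g' [Hg Hd]]].
  exists (u * c + v * d), (fun x => u * f' x + v * g' x); split; [now apply IH | ].
  intros x; rewrite Hc, Hd; ring.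
Qed.

Lemma poly_le_affine_mult (n : nat) (u v : R) (f : R -> R) :
  poly_le n f -> poly_le (S n) (fun x => (u + v * x) * f x).
Proof.
intros Hf.
apply (poly_le_ext _ (fun x => u * f x + v * (x * f x))); [intros x; ring | ].
apply poly_le_lin; [now apply poly_le_S | ].
exists 0, f; split; [exact Hf | intros x; ring].
Qed.

Lemma poly_le_affine_pow_mult (n k : nat) (u v : R) (f : R -> R) :
  poly_le n f -> poly_le (k + n) (fun x => (u + v * x) ^ k * f x).
Proof.
intros Hf; induction k as [|k IH].
- apply (poly_le_ext _ f); [intros x; simpl; ring | exact Hf].
- apply (poly_le_ext _ (fun x => (u + v * x) * ((u + v * x) ^ k * f x))).
  { intros x; simpl; ring. }
  now apply (poly_le_affine_mult (k + n)).
Qed.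

Lemma poly_le_sum_n (n m : nat) (e : nat -> R) (f : nat -> R -> R) :
  (forall l, (l <= m)%nat -> poly_le n (f l)) ->
  poly_le n (fun x => sum_n (fun l => e l * f l x) m).
Proof.
induction m as [|m IH]; intros H.
- apply (poly_le_ext _ (fun x => e 0%nat * f 0%nat x + 0 * 0)).
  { intros x; rewrite sum_O; ring. }
  apply (poly_le_lin n _ _ (f 0%nat) (fun _ => 0)); [now apply H | apply poly_le_const].
- apply (poly_le_ext _ (fun x => 1 * sum_n (fun l => e l * f l x) m
                                 + e (S m) * f (S m) x)).
  { intros x; rewrite sum_Sn; unfold plus; simpl; ring. }
  apply poly_le_lin; [apply IH; intros l Hl; apply H; lia | apply H; lia].
Qed.

(** If f = c + x h and h(x) - h(a) = (x - a) k(x), then f(x) - f(a) = (x - a) (h(a) + x k(x)). *)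
Lemma poly_le_factor (n : nat) (f : R -> R) (a : R) : poly_le (S n) f ->
  exists g, poly_le n g /\ forall x, f x - f a = (x - a) * g x.
Proof.
revert f; induction n as [|n IH]; intros f [c [h [Hh Hc]]].
- exists h; split; [exact Hh | ].
  destruct Hh as [d Hd]; intros x; rewrite !Hc, !Hd; ring.
- destruct (IH h Hh) as [k [Hk Ek]].
  exists (fun x => h a + 1 * x * k x); split.
  + exists (h a), k; split; [exact Hk | intros x; ring].
  + intros x; specialize (Ek x); rewrite !Hc.
    replace (h x) with (h a + (x - a) * k x) by lra; ring.
Qed.

Lemma poly_le_eq_0 (n : nat) (f : R -> R) (s : list R) :
  poly_le n f -> NoDup s -> (n < length s)%nat -> (forall x, In x s -> f x = 0) ->
  forall x, f x = 0.
Proof.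
revert f s; induction n as [|n IH]; intros f [|a s] Hf Hs Hl H0 x; simpl in Hl; try lia.
- destruct Hf as [c Hc]; rewrite Hc, <- (Hc a); apply H0; now left.
- destruct (poly_le_factor n f a Hf) as [g [Hg E]].
  pose proof (H0 a (or_introl eq_refl)) as Ha.
  inversion Hs as [|a' s' Hna Hs']; subst.
  pose proof (E x) as Ex; rewrite (IH g s Hg Hs') in Ex; [lra | lia | ].
  intros y Hy; specialize (E y); rewrite Ha, (H0 y (or_intror Hy)) in E.
  assert (y <> a) by (intros ->; contradiction).
  apply (Rmult_eq_reg_l (y - a)); lra.
Qed.

(** Together with their opposites, n + 1 positive roots make 2 n + 2 distinct roots. *)
Lemma poly_le_even_eq_0 (n : nat) (f : R -> R) (s : list R) :
  poly_le (2 * n) f -> (forall x, f (- x) = f x) ->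
  NoDup s -> (n < length s)%nat -> (forall x, In x s -> 0 < x /\ f x = 0) ->
  forall x, f x = 0.
Proof.
intros Hf He Hs Hl H0.
apply (poly_le_eq_0 (2 * n) f (s ++ map Ropp s) Hf).
- apply NoDup_app; [exact Hs | | ].
  + apply NoDup_map_NoDup_ForallPairs; [ | exact Hs].
    intros x y _ _ E; lra.
  + intros x Hx Hx'; apply in_map_iff in Hx'; destruct Hx' as [y [Ey Hy]].
    destruct (H0 x Hx), (H0 y Hy); lra.
- rewrite length_app, length_map; lia.
- intros x Hx; apply in_app_or in Hx; destruct Hx as [Hx|Hx]; [now apply H0 | ].
  apply in_map_iff in Hx; destruct Hx as [y [<- Hy]]; rewrite He; now apply H0.
Qed.

Lemma list_max_split (s : list R) : s <> nil ->
  exists M s1 s2, s = s1 ++ M :: s2 /\ forall x, In x s -> x <= M.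
Proof.
induction s as [|a s IH]; intros H; [congruence | ].
destruct s as [|b s].
{ exists a, nil, nil; split; [reflexivity | intros x [<-|[]]; lra]. }
destruct (IH ltac:(congruence)) as [M [s1 [s2 [E HM]]]].
destruct (Rle_dec M a) as [HaM|HaM].
- exists a, nil, (b :: s); split; [reflexivity | ].
  intros x [<-|Hx]; [lra | specialize (HM x Hx); lra].
- exists M, (a :: s1), s2; split; [simpl; now rewrite E | ].
  intros x [<-|Hx]; [lra | now apply HM].
Qed.

(** The induction removes the greatest zero [M]. The final clause keeps the earlier points below the
    next greatest zero [M'], so the new point, between [M'] and [M], differs from them. *)
Lemma Rolle_count (f df : R -> R) (n : nat) (s : list R) :
  (forall x, 0 < x < 1 -> is_derive f x (df x)) ->
  NoDup s -> length s = S n -> (forall x, In x s -> 0 < x < 1 /\ f x = 0) ->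
  exists s', NoDup s' /\ length s' = n /\
    forall x, In x s' -> (0 < x < 1 /\ df x = 0) /\ exists b, In b s /\ x < b.
Proof.
intros Hd; revert s; induction n as [|n IH]; intros s Hs Hl H0.
{ exists nil; repeat split; [constructor | contradiction | contradiction..]. }
destruct (list_max_split s) as [M [s1 [s2 [-> HM]]]]; [intros ->; discriminate | ].
pose proof (NoDup_remove _ _ _ Hs) as [Ht HMt].
assert (Hin : forall x, In x (s1 ++ s2) -> In x (s1 ++ M :: s2)).
{ intros x Hx; apply in_app_or in Hx; apply in_or_app; simpl; tauto. }
assert (Hlt : length (s1 ++ s2) = S n).
{ rewrite length_app in *; simpl in Hl; lia. }
destruct (IH (s1 ++ s2) Ht Hlt ltac:(auto)) as [s' [Hs' [Hl' H']]].
destruct (list_max_split (s1 ++ s2)) as [M' [t1 [t2 [Et HM']]]].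
{ intros E; rewrite E in Hlt; discriminate. }
assert (HM'in : In M' (s1 ++ s2)) by (rewrite Et; apply in_elt).
assert (HMin : In M (s1 ++ M :: s2)) by apply in_elt.
assert (HMM : M' < M).
{ destruct (HM M' (Hin _ HM'in)) as [|E]; [assumption | subst; contradiction]. }
destruct (H0 M HMin) as [HM01 HM0], (H0 M' (Hin _ HM'in)) as [HM01' HM0'].
destruct (MVT_cor2 f df M' M HMM) as [c [Ec Hc]].
{ intros c Hc; apply is_derive_Reals, Hd; lra. }
exists (c :: s'); repeat split.
- constructor; [ | exact Hs'].
  intros Hcs; destruct (H' c Hcs) as [_ [b [Hb Hcb]]]; specialize (HM' b Hb); lra.
- simpl; now rewrite Hl'.
- destruct H as [<-|Hx]; [lra | now apply H'].
- destruct H as [<-|Hx]; [lra | now apply H'].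
- destruct H as [<-|Hx]; [ | now apply H'].
  rewrite HM0, HM0' in Ec; apply (Rmult_eq_reg_r (M - M')); lra.
- destruct H as [<-|Hx]; [exists M; split; [exact HMin | lra] | ].
  destruct (H' x Hx) as [_ [b [Hb Hxb]]]; exists b; auto.
Qed.

(** * The bound on the number of simple zeros *)

Definition M1_coef (ap am : nat -> C) (l : nat) : R := - (Im (ap l - am l) / 2).

Definition M1_slope (m : nat) (ap am : nat -> C) (r : R) : R :=
  sum_n (fun l => M1_coef ap am l
    * (((1 + r) ^ 2 * (1 - 2 * / (1 + r)) ^ l
        + (1 - r) ^ 2 * (1 - 2 * / (1 - r)) ^ l) / r ^ 2)) m.

(** The term of [M1_eq] linear in r becomes a constant of [G], so the real parts of the coefficients
    disappear from the derivative. *)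
Lemma M1_div (m : nat) (ap am : nat -> C) : exists G : R -> R,
  (forall r, 0 < r < 1 -> M1 m ap am r = r * G r) /\
  (forall r, 0 < r < 1 -> is_derive G r (M1_slope m ap am r)).
Proof.
set (c := PI / 2 * sum_n (fun l => Re (ap l + am l) * twist (fun i => 2 - INR i) l 0) m).
exists (fun r => sum_n (fun l => M1_coef ap am l * (twist (fun i => rho i r) l 0 / r)) m - c).
split; intros r Hr.
- rewrite M1_eq by exact Hr; fold c.
  replace (sum_n _ _) with
    (r * sum_n (fun l => M1_coef ap am l * (twist (fun i => rho i r) l 0 / r)) m);
    [ring | ].
  rewrite <- (sum_n_mult_l (K := R_AbsRing) r).
  apply sum_n_ext; intros l; unfold mult, M1_coef; simpl; field; lra.
- rewrite <- (Rminus_0_r (M1_slope m ap am r)).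
  apply (is_derive_minus (V := R_NormedModule)).
  2: apply (is_derive_const (K := R_AbsRing) (V := R_NormedModule) c).
  apply (is_derive_sum_n (V := R_NormedModule)); intros l _.
  apply is_derive_scal; now apply is_derive_twist_rho.
Qed.

(* [q_l(x) (1 - x^2)^(m-2)] of the header, with the denominator cancelled. *)
Definition slope_num (m l : nat) (x : R) : R :=
  (-1 + 1 * x) ^ l * ((1 + -1 * x) ^ (m - 2) * ((1 + 1 * x) ^ (m - l) * 1)).

Lemma slope_num_eq (m l : nat) (x : R) : (2 <= m)%nat -> (l <= m)%nat -> 1 + x <> 0 ->
  slope_num m l x = (1 - x ^ 2) ^ (m - 2) * ((1 + x) ^ 2 * (1 - 2 * / (1 + x)) ^ l).
Proof.
intros Hm Hl Hx; unfold slope_num.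
replace (1 - x ^ 2) with ((1 - x) * (1 + x)) by ring.
replace (1 - 2 * / (1 + x)) with ((-1 + x) * / (1 + x)) by (field; auto).
rewrite !Rpow_mult_distr, pow_inv.
replace (-1 + 1 * x) with (-1 + x) by ring.
replace (1 + -1 * x) with (1 - x) by ring.
replace (1 + 1 * x) with (1 + x) by ring.
assert (E : (1 + x) ^ (m - 2) * (1 + x) ^ 2 = (1 + x) ^ (m - l) * (1 + x) ^ l).
{ rewrite <- !pow_add; f_equal; lia. }
pose proof (pow_nonzero (1 + x) l Hx) as Hp.
transitivity ((-1 + x) ^ l * (1 - x) ^ (m - 2) * ((1 + x) ^ (m - l) * (1 + x) ^ l) * / (1 + x) ^ l).
- field; auto.
- rewrite <- E; ring.
Qed.

(** The degrees of the three affine powers add up to l + (m - 2) + (m - l) = 2 (m - 1). *)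
Lemma poly_le_slope_num (m l : nat) : (2 <= m)%nat -> (l <= m)%nat ->
  poly_le (2 * (m - 1)) (fun x => slope_num m l x + slope_num m l (- x)).
Proof.
intros Hm Hl.
replace (2 * (m - 1))%nat with (l + ((m - 2) + ((m - l) + 0)))%nat by lia.
apply (poly_le_ext _ (fun x => 1 * slope_num m l x + 1 *
   ((-1 + -1 * x) ^ l * ((1 + 1 * x) ^ (m - 2) * ((1 + -1 * x) ^ (m - l) * 1))))).
{ intros x; unfold slope_num.
  replace (1 * - x) with (-1 * x) by ring.
  replace (-1 * - x) with (1 * x) by ring; ring. }
apply poly_le_lin.
- now apply poly_le_affine_pow_mult, poly_le_affine_pow_mult, poly_le_affine_pow_mult; exists 1.
- now apply poly_le_affine_pow_mult, poly_le_affine_pow_mult, poly_le_affine_pow_mult; exists 1.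
Qed.

Lemma M1_simple_zeros_le (m i : nat) (ap am : nat -> C) : (2 <= m)%nat ->
  has_simple_zeros (M1 m ap am) i -> (i <= m)%nat.
Proof.
intros Hm [s [Hs [Hl Hz]]].
destruct (Nat.le_gt_cases i m) as [|Hi]; [assumption | exfalso].
destruct (M1_div m ap am) as [G [HG HdG]].
assert (HG0 : forall x, In x s -> 0 < x < 1 /\ G x = 0).
{ intros x Hx; destruct (Hz x Hx) as [Hx01 [E _]]; split; [exact Hx01 | ].
  rewrite HG in E by exact Hx01; apply (Rmult_eq_reg_l x); lra. }
(* More than m zeros of [G] yield at least m zeros of its derivative, too many for the even
   polynomial [P] unless it vanishes. *)
destruct (Rolle_count G (M1_slope m ap am) (i - 1) s HdG Hs ltac:(lia) HG0)
  as [s' [Hs' [Hl' H']]].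
set (P := fun x => sum_n (fun l => M1_coef ap am l
            * (slope_num m l x + slope_num m l (- x))) m).
assert (HP : forall x, 0 < x < 1 ->
          P x = x ^ 2 * (1 - x ^ 2) ^ (m - 2) * M1_slope m ap am x).
{ intros x Hx; unfold M1_slope.
  rewrite <- (sum_n_mult_l (K := R_AbsRing) (x ^ 2 * (1 - x ^ 2) ^ (m - 2))).
  apply sum_n_ext_loc; intros l Hlm; unfold mult; simpl AbsRing.sort.
  rewrite !slope_num_eq by (assumption || lra).
  replace ((- x) ^ 2) with (x ^ 2) by ring.
  replace (1 + - x) with (1 - x) by ring.
  unfold mult; simpl; field; lra. }
assert (HP0 : forall x, P x = 0).
{ apply (poly_le_even_eq_0 (m - 1) P s'); [ | | exact Hs' | lia | ].
  - apply (poly_le_sum_n _ _ _ (fun l x => slope_num m l x + slope_num m l (- x))).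
    intros l Hlm; now apply poly_le_slope_num.
  - intros x; apply sum_n_ext; intros l.
    now rewrite Ropp_involutive, (Rplus_comm (slope_num m l (- x))).
  - intros x Hx; destruct (H' x Hx) as [[Hx01 Hx0] _].
    split; [lra | rewrite HP, Hx0 by exact Hx01; ring]. }
(* As [P] vanishes, so does the derivative of [G]. At a zero x of [M1] its derivative G(x) + x G'(x)
   is then 0, against simplicity. *)
destruct s as [|x s]; [simpl in Hl; lia | ].
destruct (Hz x (or_introl eq_refl)) as [Hx [_ [d [Hd Hd0]]]].
apply Hd0; rewrite <- (is_derive_unique _ _ _ Hd).
apply is_derive_unique.
apply (is_derive_ext_loc (fun y => y * G y)).
{ apply (locally_interval _ _ 0 1); simpl; try lra.
  intros y H0 H1; symmetry; now apply HG. }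
replace 0 with (1 * G x + x * M1_slope m ap am x).
- apply (is_derive_mult (K := R_AbsRing)); [apply (is_derive_id (K := R_AbsRing)) | now apply HdG | ].
  intros; apply Rmult_comm.
- destruct (HG0 x (or_introl eq_refl)) as [_ ->].
  assert (M1_slope m ap am x = 0) as ->; [ | ring].
  pose proof (HP x Hx) as E; rewrite HP0 in E.
  assert (0 < x ^ 2 * (1 - x ^ 2) ^ (m - 2)).
  { apply Rmult_lt_0_compat; [nra | apply pow_lt; nra]. }
  apply (Rmult_eq_reg_l (x ^ 2 * (1 - x ^ 2) ^ (m - 2))); lra.
Qed.

(** * Realizable configurations *)

Lemma has_simple_zeros_le (F : R -> R) (n k : nat) :
  (k <= n)%nat -> has_simple_zeros F n -> has_simple_zeros F k.
Proof.
intros Hk [s [Hs [Hl Hz]]].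
rewrite <- (firstn_skipn k s) in Hs, Hz.
exists (firstn k s); split; [exact (NoDup_app_remove_r _ _ Hs) | split].
- rewrite length_firstn; lia.
- intros r Hr; apply Hz, in_or_app; now left.
Qed.

(** Only maximal configurations then have to be realized. *)
Lemma realizable_le (m i j i' j' : nat) : (i <= i')%nat -> (j <= j')%nat ->
  realizable m i' j' -> realizable m i j.
Proof.
intros Hi Hj [ap [am [H1 H2]]]; exists ap, am; split.
- now apply (has_simple_zeros_le _ i').
- now apply (has_simple_zeros_le _ j').
Qed.

Lemma simple_zero_neq_0 (F : R -> R) (r : R) :
  (forall x, 0 < x < 1 -> F x = 0) -> ~ simple_zero F r.
Proof.
intros H0 [Hr [_ [d [Hd Hd0]]]]; apply Hd0.
rewrite <- (is_derive_unique _ _ _ Hd); apply is_derive_unique.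
apply (is_derive_ext_loc (fun _ => 0)).
- apply (locally_interval _ _ 0 1); simpl; try lra.
  intros y Hy0 Hy1; symmetry; now apply H0.
- apply (is_derive_const (K := R_AbsRing) (V := R_NormedModule)).
Qed.

(** Horner form, to match [poly_le 2]. *)
Definition quadratic (A b c : R) (x : R) : R := A + x * (b + x * c).

Lemma quadratic_eq_0 (A b c : R) (s : list R) :
  NoDup s -> (2 < length s)%nat -> (forall x, In x s -> quadratic A b c x = 0) ->
  forall x, quadratic A b c x = 0.
Proof.
apply poly_le_eq_0.
exists A, (fun x => b + x * c); split; [ | reflexivity].
exists b, (fun _ => c); split; [now exists c | reflexivity].
Qed.

(* The reciprocals of the zeros of [N1] are zeros of [M1] continued to [(1, oo)]. *)
Lemma M1_N1_quadratic (m : nat) (ap am : nat -> C) : (m <= 2)%nat ->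
  exists A b c, (m = 0%nat -> c = - A) /\
    (forall r, 0 < r < 1 -> M1 m ap am r = quadratic A b c r) /\
    (forall r, 0 < r < 1 -> N1 m ap am r = r ^ 2 * quadratic A b c (/ r)).
Proof.
intros Hm; destruct m as [|[|[|m]]]; [ | | | lia].
(* In [M1_eq] the terms l = 0, 1, 2 contribute 1 - r^2, - (1 + r^2), 1 - r^2, each times
   [Im (ap l - am l)]; no logarithm occurs since [kap 0] is 0. *)
- exists (Im (ap 0%nat - am 0%nat)), (- PI * Re (ap 0%nat + am 0%nat)), (- Im (ap 0%nat - am 0%nat)).
  unfold N1, quadratic; repeat split; intros r Hr; rewrite M1_eq, !sum_O by exact Hr;
    unfold reflect_coef, Im, Re; simpl; field; lra.
- exists (Im (ap 0%nat - am 0%nat) - Im (ap 1%nat - am 1%nat)),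
         (- PI * Re (ap 0%nat + am 0%nat)),
         (- Im (ap 0%nat - am 0%nat) - Im (ap 1%nat - am 1%nat)).
  unfold N1, quadratic; repeat split; [discriminate | | ];
  intros r Hr; rewrite M1_eq, !sum_Sn, !sum_O by exact Hr;
    unfold reflect_coef, Im, Re, plus; simpl; field; lra.
- exists (Im (ap 0%nat - am 0%nat) - Im (ap 1%nat - am 1%nat) + Im (ap 2%nat - am 2%nat)),
         (- PI * (Re (ap 0%nat + am 0%nat) - Re (ap 2%nat + am 2%nat))),
         (- Im (ap 0%nat - am 0%nat) - Im (ap 1%nat - am 1%nat) - Im (ap 2%nat - am 2%nat)).
  unfold N1, quadratic; repeat split; [discriminate | | ];
  intros r Hr; rewrite M1_eq, !sum_Sn, !sum_O by exact Hr;
    unfold reflect_coef, Im, Re, plus; simpl; field; lra.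
Qed.

Lemma realizable_le_2 (m i j : nat) : (m <= 2)%nat -> realizable m i j ->
  (i + j <= 2)%nat /\ (m = 0%nat -> (i + j <= 1)%nat).
Proof.
intros Hm [ap [am [[s [Hs [Hls Hzs]]] [t [Ht [Hlt Hzt]]]]]].
destruct (M1_N1_quadratic m ap am Hm) as [A [b [c [H0 [HM HN]]]]].
(* The zeros of [M1] lie below 1 and the reciprocals of the zeros of [N1] above 1, so no root is
   counted twice. *)
assert (Hu : NoDup (s ++ map Rinv t)).
{ apply NoDup_app; [exact Hs | | ].
  - apply NoDup_map_NoDup_ForallPairs; [ | exact Ht].
    intros x y _ _ E; rewrite <- (Rinv_inv x), E; apply Rinv_inv.
  - intros x Hx Hx'; apply in_map_iff in Hx'; destruct Hx' as [y [Ey Hy]].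
    destruct (Hzs x Hx) as [Hx01 _], (Hzt y Hy) as [Hy01 _].
    pose proof (Rinv_lt_contravar y 1 ltac:(lra) ltac:(lra)); rewrite Rinv_1 in *; lra. }
assert (Hlu : length (s ++ map Rinv t) = (i + j)%nat)
  by (rewrite length_app, length_map; lia).
assert (Hzu : forall x, In x (s ++ map Rinv t) -> 0 < x /\ quadratic A b c x = 0).
{ intros x Hx; apply in_app_or in Hx; destruct Hx as [Hx|Hx].
  - destruct (Hzs x Hx) as [Hx01 [E _]]; rewrite HM in E by exact Hx01; lra.
  - apply in_map_iff in Hx; destruct Hx as [y [<- Hy]].
    destruct (Hzt y Hy) as [Hy01 [E _]]; rewrite HN in E by exact Hy01.
    split; [apply Rinv_0_lt_compat; lra | ].
    apply (Rmult_eq_reg_l (y ^ 2)); [lra | apply pow_nonzero; lra]. }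
revert Hu Hlu Hzu; generalize (s ++ map Rinv t) as u; intros u Hu Hlu Hzu.
(* If the quadratic vanished, [M1] and [N1] would be 0 on (0,1) and have no simple zero. *)
assert (Hnz : (0 < i + j)%nat -> ~ forall x, quadratic A b c x = 0).
{ intros Hij Hq; destruct s as [|x s].
  - destruct t as [|x t]; [simpl in *; lia | ].
    apply (simple_zero_neq_0 (N1 m ap am) x); [ | now apply Hzt; left].
    intros y Hy; rewrite HN, Hq by exact Hy; ring.
  - apply (simple_zero_neq_0 (M1 m ap am) x); [ | now apply Hzs; left].
    intros y Hy; now rewrite HM, Hq by exact Hy. }
split.
- destruct (Nat.le_gt_cases (i + j) 2) as [|Hij]; [assumption | exfalso].
  apply Hnz; [lia | ].
  apply (quadratic_eq_0 A b c u Hu); [lia | intros x Hx; now apply Hzu].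
- intros Em; specialize (H0 Em).
  destruct (Nat.le_gt_cases (i + j) 1) as [|Hij]; [assumption | exfalso].
  apply Hnz; [lia | ].
  destruct u as [|x [|y u]]; try (simpl in Hlu; lia).
  destruct (Hzu x ltac:(now left)) as [Hx Ex], (Hzu y ltac:(now right; left)) as [Hy Ey].
  pose proof (Rinv_0_lt_compat x Hx) as Hix.
  (* For [c = - A] the product of the two roots is [-1]. *)
  apply (quadratic_eq_0 A b c (- / x :: x :: y :: nil)); [ | simpl; lia | ].
  + inversion Hu as [|x' u' Hxu Hu']; subst.
    repeat constructor; simpl in *; intuition lra.
  + intros z [<-|[<-|[<-|[]]]]; try assumption.
    transitivity (- (/ x) ^ 2 * quadratic A b c x).
    * unfold quadratic; rewrite H0; field; lra.
    * rewrite Ex; ring.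
Qed.

(** * Explicit coefficients for the realizable configurations *)

Definition log_quadratic (A b c d x : R) : R :=
  A + b * x + c * x ^ 2 + d * (x * (ln (1 + x) - ln (1 - x))).

(** The imaginary parts of the coefficients 0, 1, 3 multiply 1 - r^2, - (1 + r^2) and 4 r L - (1 +
    r^2), which gives [A], [c], [d]. The linear terms come from the real parts of the coefficients 0
    and 3; reflection flips the sign of the latter, which separates [b] from [b']. *)
Lemma M1_N1_log_quadratic (m : nat) (A b b' c d : R) : (m <= 3)%nat ->
  (m = 0%nat -> c = - A) -> ((m <= 2)%nat -> d = 0 /\ b' = b) ->
  exists ap am,
    (forall r, 0 < r < 1 -> M1 m ap am r = log_quadratic A b c d r) /\
    (forall r, 0 < r < 1 -> N1 m ap am r = log_quadratic c b' A d r).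
Proof.
intros Hm H0 H2.
exists (fun l => match l with
       | 0%nat => (- (b + b') / (2 * PI), (A - c) / 2)
       | 1%nat => (0, - (A + c) / 2 - d / 4)
       | 2%nat => (0, 0)
       | _ => ((b' - b) / (4 * PI), d / 4)
       end), (fun _ => RtoC 0).
pose proof PI_RGT_0 as HPI.
unfold N1, log_quadratic; destruct m as [|[|[|[|m]]]]; [ | | | | lia];
  try (destruct (H2 ltac:(lia)) as [-> ->]); try rewrite (H0 eq_refl);
  split; intros r Hr; rewrite M1_eq, ?sum_Sn, ?sum_O by exact Hr;
  unfold reflect_coef, Im, Re, plus; simpl; field; lra.
Qed.

(** Bounds sharp enough to show that the derivatives at the chosen zeros do not vanish. *)
Lemma ln_3_inv_bounds : 10 / 17 < / ln 3 <= 1.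
Proof.
assert (H1 : 1 <= ln 3).
{ rewrite <- (ln_exp 1); apply ln_le; [apply exp_pos | apply exp_le_3]. }
assert (H2 : ln 3 < 17 / 10).
{ rewrite <- (ln_exp (17 / 10)); apply ln_increasing; [lra | ].
  replace (17 / 10) with (17 / 20 + 17 / 20) by lra; rewrite exp_plus.
  (* The square of 1 + 17/20 already exceeds 3. *)
  pose proof (exp_ineq1 (17 / 20) ltac:(lra)); nra. }
split.
- replace (10 / 17) with (/ (17 / 10)) by field; apply Rinv_lt_contravar; nra.
- rewrite <- Rinv_1; apply Rinv_le_contravar; lra.
Qed.

(* At a point where [(1 + r) / (1 - r) = 3 ^ n] the logarithmic term is rational
   once [d] is a rational multiple of [/ ln 3]. *)
Lemma log_quadratic_simple_zero (F : R -> R) (A b c k r : R) (n : nat) :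
  (forall x, 0 < x < 1 -> F x = log_quadratic A b c (k * / ln 3) x) -> 0 < r < 1 ->
  1 + r = 3 ^ n * (1 - r) ->
  A + b * r + c * r ^ 2 + k * INR n * r = 0 ->
  b + 2 * c * r + k * INR n + k * (2 * r / (1 - r ^ 2)) * / ln 3 <> 0 ->
  simple_zero F r.
Proof.
intros HF Hr En H0 HD.
pose proof ln_3_inv_bounds as Hq.
assert (H3 : ln 3 <> 0) by (intros E; rewrite E, Rinv_0 in Hq; lra).
assert (HL : ln (1 + r) - ln (1 - r) = INR n * ln 3).
{ rewrite En, ln_mult, ln_pow; [ring | lra | apply pow_lt; lra | lra]. }
split; [exact Hr | split].
- rewrite HF by exact Hr; unfold log_quadratic; rewrite HL, <- H0; field; exact H3.
- eexists; split; [ | exact HD].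
  apply (is_derive_ext_loc (log_quadratic A b c (k * / ln 3))).
  { apply (locally_interval _ _ 0 1); simpl; try lra.
    intros x Hx0 Hx1; symmetry; now apply HF. }
  unfold log_quadratic; auto_derive; [lra | ].
  change (1 + - r) with (1 - r).
  replace (ln (1 + r) + - ln (1 - r)) with (INR n * ln 3) by lra.
  field; repeat split; try lra; nra.
Qed.

Lemma realizable_3_3_1 : realizable 3 3 1.
Proof.
pose proof ln_3_inv_bounds as Hq.
(* At 1/2, 4/5, 13/14 the quotient (1 + r) / (1 - r) is 3, 9, 27. Zeros of [M1] there fix [A], [b],
   [c], [d] up to a common factor; [b'] is then chosen to make [N1] vanish at 1/2. *)
destruct (M1_N1_log_quadratic 3 156 (-534) (- 2175 / 2) 525 (- (81 / 2) * / ln 3))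
  as [ap [am [HM HN]]]; [lia | discriminate | lia | ].
exists ap, am; split.
- exists (1 / 2 :: 4 / 5 :: 13 / 14 :: nil); split; [ | split; [reflexivity | ]].
  { repeat constructor; simpl; intuition lra. }
  intros r [<-|[<-|[<-|[]]]].
  + apply (log_quadratic_simple_zero _ _ _ _ _ _ 1 HM); simpl; lra.
  + apply (log_quadratic_simple_zero _ _ _ _ _ _ 2 HM); simpl; lra.
  + apply (log_quadratic_simple_zero _ _ _ _ _ _ 3 HM); simpl; lra.
- exists (1 / 2 :: nil); split; [ | split; [reflexivity | ]].
  { repeat constructor; simpl; tauto. }
  intros r [<-|[]].
  apply (log_quadratic_simple_zero _ _ _ _ _ _ 1 HN); simpl; lra.
Qed.

Lemma realizable_3_2_2 : realizable 3 2 2.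
Proof.
pose proof ln_3_inv_bounds as Hq.
(* With A = c and b = b' the functions [M1] and [N1] agree on (0,1), so both zeros serve twice. *)
destruct (M1_N1_log_quadratic 3 1 (- 59 / 20) (- 59 / 20) 1 (9 / 20 * / ln 3))
  as [ap [am [HM HN]]]; [lia | discriminate | lia | ].
assert (HZ : forall F, (forall x, 0 < x < 1 ->
    F x = log_quadratic 1 (- 59 / 20) 1 (9 / 20 * / ln 3) x) -> has_simple_zeros F 2).
{ intros F HF; exists (1 / 2 :: 4 / 5 :: nil); split; [ | split; [reflexivity | ]].
  { repeat constructor; simpl; intuition lra. }
  intros r [<-|[<-|[]]].
  + apply (log_quadratic_simple_zero _ _ _ _ _ _ 1 HF); simpl; lra.
  + apply (log_quadratic_simple_zero _ _ _ _ _ _ 2 HF); simpl; lra. }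
exists ap, am; split; now apply HZ.
Qed.

Lemma quadratic_simple_zero (F : R -> R) (A b c r : R) :
  (forall x, 0 < x < 1 -> F x = log_quadratic A b c 0 x) -> 0 < r < 1 ->
  A + b * r + c * r ^ 2 = 0 -> b + 2 * c * r <> 0 -> simple_zero F r.
Proof.
intros HF Hr H0 HD; split; [exact Hr | split].
- rewrite HF by exact Hr; unfold log_quadratic; lra.
- eexists; split; [ | exact HD].
  apply (is_derive_ext_loc (fun x => A + b * x + c * x ^ 2)).
  { apply (locally_interval _ _ 0 1); simpl; try lra.
    intros x Hx0 Hx1; rewrite HF by lra; unfold log_quadratic; ring. }
  auto_derive; [auto | ring].
Qed.

Lemma realizable_0_1_0 : realizable 0 1 0.
Proof.
(* The polynomial is (1 - 2 x) (1 + x / 2), with product of roots -1. *)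
destruct (M1_N1_log_quadratic 0 1 (- 3 / 2) (- 3 / 2) (-1) 0)
  as [ap [am [HM _]]]; [lia | lra | auto | ].
exists ap, am; split.
- exists (1 / 2 :: nil); split; [repeat constructor; simpl; tauto | split; [reflexivity | ]].
  intros r [<-|[]]; apply (quadratic_simple_zero _ _ _ _ _ HM); lra.
- exists nil; split; [constructor | split; [reflexivity | contradiction]].
Qed.

Lemma realizable_2_0 (m : nat) : m = 1%nat \/ m = 2%nat -> realizable m 2 0.
Proof.
intros Hm.
(* The polynomial is (1 - 2 x) (1 - 3 x). *)
destruct (M1_N1_log_quadratic m 1 (-5) (-5) 6 0)
  as [ap [am [HM _]]]; [lia | lia | auto | ].
exists ap, am; split.
- exists (1 / 2 :: 1 / 3 :: nil); split; [ | split; [reflexivity | ]].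
  { repeat constructor; simpl; intuition lra. }
  intros r [<-|[<-|[]]]; apply (quadratic_simple_zero _ _ _ _ _ HM); lra.
- exists nil; split; [constructor | split; [reflexivity | contradiction]].
Qed.

Lemma realizable_1_1 (m : nat) : m = 1%nat \/ m = 2%nat -> realizable m 1 1.
Proof.
intros Hm.
(* This polynomial is palindromic with roots 1/2 and 2, so [N1] has the same zero as [M1]. *)
destruct (M1_N1_log_quadratic m 2 (-5) (-5) 2 0)
  as [ap [am [HM HN]]]; [lia | lia | auto | ].
exists ap, am; split; exists (1 / 2 :: nil);
  (split; [repeat constructor; simpl; tauto | split; [reflexivity | ]]);
  intros r [<-|[]].
- apply (quadratic_simple_zero _ _ _ _ _ HM); lra.
- apply (quadratic_simple_zero _ _ _ _ _ HN); lra.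
Qed.

Theorem theorem3 :
  (* (a) *)
  ((forall i j : nat, realizable 0 i j <-> (0 <= i + j <= 1)%nat) /\
   (forall m i j : nat, (m = 1%nat \/ m = 2%nat) ->
      (realizable m i j <-> (i + j <= 2)%nat))) /\
  (* (b) *)
  ((forall i j : nat, realizable 3 i j -> (i <= 3)%nat /\ (j <= 3)%nat) /\
   (forall i j : nat,
      (0 <= i + j <= 4)%nat -> (i <= 3)%nat -> (j <= 3)%nat ->
      realizable 3 i j)) /\
  (* (c) *)
  (forall m i j : nat, (3 < m)%nat -> realizable m i j ->
     (i <= 2 * m - 3)%nat /\ (j <= 2 * m - 3)%nat).
Proof.
(* [N1] is by definition an [M1] with other coefficients, so one bound covers both; for m > 3 it is
   stronger than 2 m - 3. *)
assert (Hle : forall m i j, (2 <= m)%nat -> realizable m i j -> (i <= m)%nat /\ (j <= m)%nat).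
{ intros m i j Hm [ap [am [H1 H2]]].
  split; eapply M1_simple_zeros_le; [exact Hm | exact H1 | exact Hm | exact H2]. }
split; [split | split; [split | ]].
- intros i j; split.
  + intros H; apply realizable_le_2 in H; [ | lia].
    destruct H as [_ H]; specialize (H eq_refl); lia.
  + intros Hij; destruct i as [|i].
    * apply realizable_sym, (realizable_le 0 j 0 1 0); [lia | lia | exact realizable_0_1_0].
    * apply (realizable_le 0 (S i) j 1 0); [lia | lia | exact realizable_0_1_0].
- intros m i j Hm; split.
  + intros H; apply realizable_le_2 in H; [apply H | lia].
  + intros Hij; destruct i as [|[|i]].
    * apply realizable_sym, (realizable_le m j 0 2 0); [lia | lia | now apply realizable_2_0].
    * apply (realizable_le m 1 j 1 1); [lia | lia | now apply realizable_1_1].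
    * apply (realizable_le m (S (S i)) j 2 0); [lia | lia | now apply realizable_2_0].
- intros i j; apply Hle; lia.
(* Every pair in question lies below [3,1], [2,2] or [1,3]. *)
- intros i j Hij Hi Hj; destruct (Nat.le_gt_cases i 1) as [Hi1|Hi1].
  + apply realizable_sym, (realizable_le 3 j i 3 1); [lia | lia | exact realizable_3_3_1].
  + destruct (Nat.eq_dec i 2) as [->|Hi2].
    * apply (realizable_le 3 2 j 2 2); [lia | lia | exact realizable_3_2_2].
    * apply (realizable_le 3 i j 3 1); [lia | lia | exact realizable_3_3_1].
- intros m i j Hm H; apply Hle in H; lia.
Qed.
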